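(* Let $a$ be a prime, $s\ge1$, $k_1,\dots,k_s\ge0$ integers, $F=F_{a^{k_1}}\otimes\cdots\otimes F_{a^{k_s}}$ of size $N=a^{k_1+\cdots+k_s}$ with indexing group $I_F=\mathbb Z_{a^{k_1}}\times\cdots\times\mathbb Z_{a^{k_s}}$, $k_{\max}=\max_x k_x$, and $K(l)=\#\{x: k_x<l\}$. If $k_{\max}=0$ then $\mathbf D(F)=1$. If $k_{\max}>0$ then: (a) $\mathbf D(F)=\sum_{m=0}^{k_{\max}}\frac{N}{a^m}\,n_m$, where $n_m$ is the number of elements of order $a^m$ in $I_F$ (equivalently, the number of rows of $F$ consisting of $a^m$-th roots of unity). (b) $\mathbf D(F)=\frac Na\Big((a-1)\big(1+\sum_{m=1}^{k_{\max}}a^{-m+\sum_{x=1}^s\min(k_x,m)}\big)+a^{-k_{\max}+\sum_{x=1}^sk_x}\Big)$. (c) $\mathbf D(F)=\frac Na\Big((a-1)\big(1+\sum_{m=1}^{k_{\max}}a^{sm-\sum_{l=1}^m(K(l)+1)}\big)+a^{sk_{\max}-\sum_{l=1}^{k_{\max}}(K(l)+1)}\Big)$, and $sk_{\max}-\sum_{l=1}^{k_{\max}}(K(l)+1)=-k_{\max}+\sum_xk_x$. (d) Let $0<c_1<\dots<c_r=k_{\max}$ be the distinct nonzero values among the $k_x$, and set $c_0=0$. For $(\alpha,\beta)=(c_{y-1},c_y)$, $y=1,\dots,r$, let $\mu=s-K(\beta)-1\ (\ge0)$ and $$P(\alpha,\beta)=a^{\sum_{k_x\le\alpha}k_x+\mu(\alpha+1)}\sum_{d=0}^{\beta-\alpha-1}a^{\mu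 d}$$ (empty sums are $0$; note $\sum_{k_x\le\alpha}k_x+\mu(\alpha+1)=s(\alpha+1)-\sum_{l=1}^{\alpha+1}(K(l)+1)$). Then $\mu=0$ exactly when $y=r$ and $k_{\max}$ occurs only once among the $k_x$, in which case $P(\alpha,\beta)=a^{\sum_{k_x\le\alpha}k_x}(\beta-\alpha)$; otherwise $P(\alpha,\beta)=a^{\sum_{k_x\le\alpha}k_x+\mu(\alpha+1)}\frac{1-a^{\mu(\beta-\alpha)}}{1-a^{\mu}}$. Moreover $$\mathbf D(F)=\frac Na\Big((a-1)\big(1+P(c_0,c_1)+P(c_1,c_2)+\cdots+P(c_{r-1},c_r)\big)+a^{-k_{\max}+\sum_xk_x}\Big),$$ and the degrees (as polynomials in $a$) of $1,P(c_0,c_1),\dots,P(c_{r-1},c_r)$ form an increasing sequence, except that the last two degrees are equal, which happens if and only if $k_{\max}$ occurs exactly once among the $k_x$. (e) $\mathbf D(F)=\frac Na\Big((a-1)\big(1+a^{e_1}(1+a^{e_2}(1+\cdots(1+a^{e_{k_{\max}}})\cdots))\big)+a^{sk_{\max}-\sum_{l=1}^{k_{\max}}(K(l)+1)}\Big)$ with $e_m=s-(K(m)+1)$; each $e_m\ge0$, and $e_m=0$ if and only if $k_{\max}$ occurs exactly once among the $k_x$ and $c_{r-1}+1\le m\le c_r$.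
   Context: For $n\ge1$, $F_n$ is the $n\times n$ matrix with rows and columns indexed by $\mathbb Z_n$ and entries $e^{2\pi i\,\tilde i\tilde j/n}$, and a Kronecker product $F_{N_1}\otimes\cdots\otimes F_{N_r}$ is indexed by $\mathbb Z_{N_1}\times\cdots\times\mathbb Z_{N_r}$ (entry at $(i,j)$ is $\prod_x(F_{N_x})_{i_x,j_x}$). For an $N\times N$ matrix $V$ with no zero entries and $V=\alpha U$ with $U$ unitary and $\alpha\ne0$, the undephased defect is $\mathbf D(V)=\dim_{\mathbb R}\{iR\circ V:\ R\text{ real},\ (iR\circ V)V^*\text{ antihermitian}\}$ ($\circ$ entrywise product). For a Fourier matrix this equals the number of entries of $F$ equal to $1$. *)

(* Defs.v *)
From HB Require Import structures.
From mathcomp Require Import all_boot all_order all_algebra.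
From mathcomp Require Import reals trigo.
From mathcomp Require Import complex.
Set Implicit Arguments. Unset Strict Implicit. Unset Printing Implicit Defensive.
Import Order.TTheory GRing.Theory Num.Theory.
Local Open Scope ring_scope.
Local Open Scope complex_scope.

Section Defect.
Variable R : realType.

Definition root_n (n : nat) : R[i] :=
  Complex (cos (2 * pi / n%:R)) (sin (2 * pi / n%:R)).

Definition defect_cond (T : finType) (V : T -> T -> R[i]) (R0 : T -> T -> R) : Prop :=
  let A := fun i j => 'i * (R0 i j)%:C * V i j in
  let M := fun i j => \sum_(t : T) A i t * (V j t)^* in
  forall i j, (M j i)^* = - M i j.

Definition in_defect_space (T : finType) (V : T -> T -> R[i]) (B : T -> T -> R[i]) : Prop :=
  exists R0 : T -> T -> R, defect_cond V R0 /\ B = (fun i j => 'i * (R0 i j)%:C * V i j).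

Definition real_indep (T : finType) (d : nat) (B : 'I_d -> T -> T -> R[i]) : Prop :=
  forall c : 'I_d -> R,
    (forall i j, \sum_(t < d) (c t)%:C * B t i j = 0) -> forall t, c t = 0.

Definition is_undephased_defect (T : finType) (V : T -> T -> R[i]) (D : nat) : Prop :=
  (exists B : 'I_D -> T -> T -> R[i], (forall t, in_defect_space V (B t)) /\ real_indep B) /\
  (forall (d : nat) (B : 'I_d -> T -> T -> R[i]),
      (forall t, in_defect_space V (B t)) -> real_indep B -> (d <= D)%N).

End Defect.

Definition IF (a s : nat) (k : 'I_s -> nat) : finType :=
  {dffun forall x : 'I_s, 'I_(a ^ k x)}.

Definition FourierKron (R : realType) (a s : nat) (k : 'I_s -> nat)
  : IF a k -> IF a k -> R[i] :=
  fun i j => \prod_(x < s) root_n R (a ^ k x) ^+ (i x * j x).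

Arguments FourierKron R a [s] k _ _.

Definition kills (a s : nat) (k : 'I_s -> nat) (t : nat) (g : IF a k) : bool :=
  [forall x, (a ^ k x %| t * g x)%N].

Definition has_order (a s : nat) (k : 'I_s -> nat) (g : IF a k) (t : nat) : bool :=
  [&& (0 < t)%N, kills t g & [forall u : 'I_t, (0 < u)%N ==> ~~ kills u g]].

Definition n_ord (a s : nat) (k : 'I_s -> nat) (m : nat) : nat :=
  #|[set g : IF a k | has_order g (a ^ m)]|.

Definition row_is_roots (R : realType) (T : finType) (V : T -> T -> R[i]) (i : T) (n : nat) : Prop :=
  (forall j, V i j ^+ n = 1) /\ (forall z : R[i], z ^+ n = 1 -> exists j, V i j = z).

Definition Nsize (a s : nat) (k : 'I_s -> nat) : nat := (a ^ (\sum_(x < s) k x))%N.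
Definition kmax (s : nat) (k : 'I_s -> nat) : nat := (\max_(x < s) k x)%N.
Definition Kc (s : nat) (k : 'I_s -> nat) (l : nat) : nat := #|[set x : 'I_s | (k x < l)%N]|.
Definition kmax_once (s : nat) (k : 'I_s -> nat) : bool :=
  #|[set x : 'I_s | k x == kmax k]| == 1%N.

Definition cseq (s : nat) (k : 'I_s -> nat) : seq nat :=
  0%N :: sort leq (undup [seq k x | x <- enum 'I_s & k x != 0%N]).
Definition cval (s : nat) (k : 'I_s -> nat) (y : nat) : nat := nth 0%N (cseq k) y.
Definition rnum (s : nat) (k : 'I_s -> nat) : nat := (size (cseq k)).-1.

(* for (alpha, beta) = (c_{y-1}, c_y): mu = s - K(beta) - 1 (nat; claimed >= 0) *)
Definition mu_y (s : nat) (k : 'I_s -> nat) (y : nat) : nat :=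
  (s - Kc k (cval k y) - 1)%N.
Definition sum_le (s : nat) (k : 'I_s -> nat) (alpha : nat) : nat :=
  (\sum_(x < s | (k x <= alpha)%N) k x)%N.

Definition Ppoly (s : nat) (k : 'I_s -> nat) (y : nat) : {poly rat} :=
  let alpha := cval k y.-1 in
  let beta := cval k y in
  let mu := mu_y k y in
  'X^(sum_le k alpha + mu * alpha.+1) * \sum_(d < beta - alpha) 'X^(mu * d).

(* degree (as polynomial in a) of the y-th term in 1, P(c_0,c_1), ..., P(c_{r-1},c_r) *)
Definition Pdeg (s : nat) (k : 'I_s -> nat) (y : nat) : nat :=
  if y == 0%N then 0%N else (size (Ppoly k y)).-1.

Definition sumK1 (s : nat) (k : 'I_s -> nat) (m : nat) : nat :=
  (\sum_(1 <= l < m.+1) (Kc k l).+1)%N.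

Definition e_m (s : nat) (k : 'I_s -> nat) (m : nat) : int := s%:Z - (Kc k m).+1%:Z.

Definition nested (a s : nat) (k : 'I_s -> nat) : rat :=
  foldr (fun m acc => 1 + (a%:Q) ^ (e_m k m) * acc) 1 (iota 1 (kmax k)).

(* Main.v *)
(* Write chi(p, q) = F(p1, q1) F(p2, q2) for pairs of indices. In the double
   Fourier transform of a real matrix R, the condition on R o F says that the
   coefficient at (h, g) vanishes unless F(h, g) = 1. Reality is handled by the
   functions Re chi + Im chi (cos + sin, as in the Hartley transform), a real
   orthogonal basis invariant under the pairing (h, g) <-> (-h, -g); those with
   F(h, g) = 1 form a basis of the solution space, so D(F) counts the entries
   equal to 1. Row g of order a^m has N / a^m such entries, and
   #{g : a^m g = 0} = a^(sum_x min(k_x, m)); the remaining formulas are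
   summation by parts and the fact that sum_x min(k_x, m) is affine in m between
   consecutive values of the k_x. *)
Require Import Defs.
From HB Require Import structures.
From mathcomp Require Import all_boot all_order all_algebra.
From mathcomp Require Import reals trigo.
From mathcomp Require Import complex.
From mathcomp Require Import ring zify.
Set Implicit Arguments. Unset Strict Implicit. Unset Printing Implicit Defensive.
Import Order.TTheory GRing.Theory Num.Theory.
Local Open Scope ring_scope.

(** * The undephased defect of a symmetric bicharacter *)

Section Cas.
Variable R : realType.
Implicit Types z w : R[i].

(** At $z=e^{i\theta}$ this is the Hartley kernel $\cos\theta+\sin\theta$. It is only
    real-linear. *)
Definition cas z : R := complex.Re z + complex.Im z.

Lemma cas0 : cas 0 = 0.
Proof. by rewrite /cas /= addr0. Qed.

Lemma casD z w : cas (z + w) = cas z + cas w.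
Proof. by case: z w => [a b] [c d]; rewrite /cas /= addrACA. Qed.

Lemma cas_sum (I : finType) (f : I -> R[i]) :
  cas (\sum_i f i) = \sum_i cas (f i).
Proof. exact: (big_morph cas casD cas0). Qed.

Lemma casZ (x : R) z : cas (real_complex _ x * z) = x * cas z.
Proof. by case: z => [a b]; rewrite /cas /=; ring. Qed.

Lemma casM z w :
  cas z * cas w = complex.Re (z * w^*) + complex.Im (z * w).
Proof. by case: z w => [a b] [c d]; rewrite /cas /=; ring. Qed.

(** Expresses [cas] through a character and its conjugate, so that complex orthogonality of rows
    applies to it. *)
Lemma cas_complex z :
  real_complex _ (cas z) = 2^-1 * ((1 - 'i) * z + (1 + 'i) * z^*).
Proof.
apply: (@mulfI _ 2); first by rewrite pnatr_eq0.
rewrite mulrA mulfV ?pnatr_eq0// mul1r.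
have -> : 2 = real_complex R 2 by rewrite rmorph_nat.
have -> : 'i = Complex 0 1 :> R[i] by [].
case: z => [a b]; apply/eqP; rewrite eq_complex /cas /=.
by apply/andP; split; apply/eqP; ring.
Qed.

Lemma Re_sum (I : finType) (f : I -> R[i]) :
  complex.Re (\sum_i f i) = \sum_i complex.Re (f i).
Proof. exact: (raddf_sum (@complex.Re R : Rcomplex R -> R)). Qed.

Lemma Im_sum (I : finType) (f : I -> R[i]) :
  complex.Im (\sum_i f i) = \sum_i complex.Im (f i).
Proof. exact: (raddf_sum (@complex.Im R : Rcomplex R -> R)). Qed.

End Cas.

(** * The defect space of a symmetric bicharacter *)

Section Bicharacter.
Variables (R : realType) (T : finType) (F : T -> T -> R[i]).
Variables (add : T -> T -> T) (e : T).
Hypothesis F_sym : forall i j, F i j = F j i.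
Hypothesis F_add : forall i j t, F (add i j) t = F i t * F j t.
Hypothesis F_e : forall t, F e t = 1.
Hypothesis F_conj : forall i t, F i t * (F i t)^* = 1.
Hypothesis F_ortho : forall i j,
  \sum_t F i t * (F j t)^* = (#|T| * (i == j))%:R.

Definition unit_entries : {set T * T} := [set p | F p.1 p.2 == 1].

Lemma bichar_card_gt0 : (0 < #|T|)%N.
Proof. by apply/card_gt0P; exists e. Qed.

(** Equal rows have inner product [#|T|], since entries are unimodular; orthogonality permits this
    only on the diagonal. *)
Lemma bichar_row_inj i j : (forall t, F i t = F j t) -> i = j.
Proof.
move=> Fij; apply/eqP; have := F_ortho i j.
under eq_bigr do rewrite Fij F_conj.
rewrite sumr_const -[1 *+ _]/(_%:R) => /eqP; rewrite eqr_nat.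
by case: (i == j); rewrite // muln0 eqn0Ngt bichar_card_gt0.
Qed.

Lemma bichar_neq0 i t : F i t != 0.
Proof.
by apply/eqP=> F0; have := F_conj i t; rewrite F0 mul0r => /eqP; rewrite eq_sym oner_eq0.
Qed.

Lemma bichar_add_inj g : injective (add g).
Proof.
move=> i j addij; apply: bichar_row_inj => t.
by apply: (mulfI (bichar_neq0 g t)); rewrite -!F_add addij.
Qed.

Lemma bichar_sum i : \sum_t F i t = (#|T| * (i == e))%:R.
Proof.
by rewrite -F_ortho; apply: eq_bigr => t _; rewrite F_e rmorph1 mulr1.
Qed.

Definition chi (p q : T * T) : R[i] := F p.1 q.1 * F p.2 q.2.

Lemma sum_mul_pair (f g : T -> R[i]) :
  \sum_(r : T * T) f r.1 * g r.2 = (\sum_i f i) * (\sum_t g t).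
Proof.
rewrite -(pair_bigA _ (fun i t => f i * g t)) mulr_suml.
by apply: eq_bigr => i _; rewrite mulr_sumr.
Qed.

(** By [casM] the sum is the real part of a Hermitian inner product plus the imaginary part of a
    full character sum. The latter is a natural number, so only the former survives. *)
Lemma cas_ortho p q :
  \sum_r cas (chi p r) * cas (chi q r) = ((#|T| ^ 2) * (p == q))%:R.
Proof.
under eq_bigr do rewrite casM.
rewrite big_split -Re_sum -Im_sum /=.
have -> : \sum_r chi p r * (chi q r)^* = ((#|T| ^ 2) * (p == q))%:R.
  rewrite (eq_bigr (fun r => (F p.1 r.1 * (F q.1 r.1)^*)
                           * (F p.2 r.2 * (F q.2 r.2)^*))); last first.
    by move=> r _; rewrite /chi rmorphM mulrACA.
  rewrite (sum_mul_pair (fun i => F p.1 i * (F q.1 i)^*)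
                   (fun i => F p.2 i * (F q.2 i)^*)) !F_ortho -natrM mulnACA.
  by case: p q => [a b] [c d]; rewrite mulnb.
have -> : \sum_r chi p r * chi q r
    = (#|T| * (add p.1 q.1 == e) * (#|T| * (add p.2 q.2 == e)))%:R.
  rewrite natrM -!bichar_sum -sum_mul_pair; apply: eq_bigr => r _.
  by rewrite /chi !F_add mulrACA.
have nat_complex n : (n%:R : R[i]) = Complex n%:R 0.
  by rewrite -[RHS]/(real_complex _ _) rmorph_nat.
by rewrite !nat_complex /= addr0.
Qed.

(** Hartley inversion: as [chi] is symmetric in its two arguments, orthogonality makes the transform
    its own inverse up to the factor $|T|^2$. *)
Lemma cas_expand (f : T * T -> R) q :
  \sum_p (\sum_r f r * cas (chi p r)) * cas (chi p q) = (#|T| ^ 2)%:R * f q.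
Proof.
have chiC p r : chi p r = chi r p by rewrite /chi F_sym [F p.2 _]F_sym.
under eq_bigr do rewrite mulr_suml.
rewrite exchange_big /= (bigD1 q) //= [X in _ + X]big1 ?addr0 => [|r rq].
  under eq_bigr do rewrite -mulrA chiC.
  by rewrite -mulr_sumr cas_ortho eqxx muln1 mulrC.
under eq_bigr do rewrite -mulrA chiC [chi _ q]chiC.
by rewrite -mulr_sumr cas_ortho (negbTE rq) muln0 mulr0.
Qed.

(** Conjugating entry (j, i) restores the product [F i t * (F j t)^*] and turns ['i] into [- 'i];
    the sign of antihermitianity absorbs this, and ['i] cancels. *)
Lemma defect_condE (f : T -> T -> R) : defect_cond F f <->
  forall i j, \sum_t real_complex _ (f i t) * (F i t * (F j t)^*)
            = \sum_t real_complex _ (f j t) * (F i t * (F j t)^*).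
Proof.
rewrite /defect_cond; split=> cond i j; have := cond i j.
  rewrite -[conjc _]/((_)^*) rmorph_sum /= -sumrN => eq_ij.
  apply: (mulfI (neq0Ci R[i])); rewrite !mulr_sumr.
  apply/esym/(@oppr_inj R[i]); rewrite -!sumrN.
  transitivity (\sum_i0 - ('i * real_complex _ (f i i0) * F i i0 * (F j i0)^*)).
    rewrite -eq_ij; apply: eq_bigr => t _.
    rewrite !rmorphM /= conjCK conjCi -[(real_complex _ _)^*]/(conjc _) conjc_real.
    by ring.
  by apply: eq_bigr => t _; ring.
move=> eq_ij; rewrite -[conjc _]/((_)^*) rmorph_sum /=.
apply: (@oppr_inj R[i]); rewrite opprK -sumrN.
transitivity ('i * (\sum_t real_complex _ (f j t) * (F i t * (F j t)^*))).
  rewrite mulr_sumr; apply: eq_bigr => t _.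
  rewrite !rmorphM /= conjCK conjCi -[(real_complex _ _)^*]/(conjc _) conjc_real.
  by ring.
by rewrite -eq_ij mulr_sumr; apply: eq_bigr => t _; ring.
Qed.

(** By [cas_complex] and orthogonality, each side is supported on [add g i = j] and [i = add g j],
    and the row [x] enters only through [F h x]. On either support [F h g = 1] forces
    [F h i = F h j], so the two sides agree. *)
Lemma cas_in_defect_space p : p \in unit_entries ->
  defect_cond F (fun i t => cas (chi p (i, t))).
Proof.
case: p => h g; rewrite inE /= => /eqP Fhg; apply/defect_condE => i j.
have row x : \sum_t real_complex _ (cas (chi (h, g) (x, t))) * (F i t * (F j t)^*)
    = 2^-1 * ((1 - 'i) * F h x * (#|T| * (add g i == j))%:R
            + (1 + 'i) * (F h x)^* * (#|T| * (i == add g j))%:R).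
  rewrite -!F_ortho !mulr_sumr -big_split mulr_sumr /=.
  apply: eq_bigr => t _; rewrite cas_complex /chi /= rmorphM !F_add rmorphM /=.
  by ring.
rewrite !row; case: eqVneq => [ji|_]; case: eqVneq => [ij|_];
  rewrite ?muln0 ?mulr0 //.
- have -> : F h i = F h j by rewrite F_sym ij F_add F_sym Fhg mul1r F_sym.
  by [].
- have -> : F h j = F h i by rewrite F_sym -ji F_add F_sym Fhg mul1r F_sym.
  by [].
- have -> : F h i = F h j by rewrite F_sym ij F_add F_sym Fhg mul1r F_sym.
  by [].
Qed.

(* Applying the defect condition to rows add g j and j shows that the transform
   of f at (h, g) is multiplied by F h g under the reindexing j -> add g j. *)
Lemma defect_cas_ortho (f : T -> T -> R) p : defect_cond F f ->
  p \notin unit_entries -> \sum_r f r.1 r.2 * cas (chi p r) = 0.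
Proof.
case: p => h g /defect_condE cond; rewrite inE /= => Fhg.
pose rowsum i := \sum_t real_complex _ (f i t) * F g t.
pose c := \sum_i F h i * rowsum i.
have rowsum_add j : rowsum (add g j) = rowsum j.
  have := cond (add g j) j; rewrite /rowsum.
  under eq_bigr do rewrite F_add -mulrA F_conj mulr1.
  by under [X in _ = X]eq_bigr do rewrite F_add -mulrA F_conj mulr1.
have c0 : c = 0.
  have: c = F h g * c.
    rewrite {1}/c (reindex_inj (@bichar_add_inj g)) mulr_sumr.
    apply: eq_bigr => j _.
    by rewrite rowsum_add F_sym F_add [F g h]F_sym [F j h]F_sym mulrA.
  move/eqP; rewrite -subr_eq0 -{1}[c]mul1r -mulrBl mulf_eq0 subr_eq0.
  by rewrite eq_sym (negbTE Fhg) => /eqP.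
transitivity (cas c); last by rewrite c0 cas0.
rewrite /c.
under [in RHS]eq_bigr do rewrite mulr_sumr.
rewrite pair_bigA cas_sum; apply: eq_bigr => r _ /=.
by rewrite -casZ /chi /=; congr cas; ring.
Qed.

Lemma undephased_defect_bichar : is_undephased_defect F #|unit_entries|.
Proof.
have N2 : (#|T| ^ 2)%:R != 0 :> R.
  by rewrite pnatr_eq0 expn_eq0 andbT -lt0n bichar_card_gt0.
have IF0 i t : ('i : R[i]) * F i t != 0.
  by rewrite mulf_neq0 ?neq0Ci ?bichar_neq0.
split.
  exists (fun x i t => 'i * real_complex _ (cas (chi (enum_val x) (i, t))) * F i t).
  split=> [x|c c0 x].
    by eexists; split; [exact: cas_in_defect_space (enum_valP x)|].
  (* Each entry of the relation carries the nonzero factor ['i * F i t]; dividing by it leaves a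
     real relation between [cas] functions. *)
  have real0 i t : \sum_x c x * cas (chi (enum_val x) (i, t)) = 0.
    apply: (@complexI R); apply: (mulfI (IF0 i t)).
    rewrite mulr0 -[RHS](c0 i t) rmorph_sum /= mulr_sumr.
    by apply: eq_bigr => y _; rewrite rmorphM /=; ring.
  have: \sum_r (\sum_y c y * cas (chi (enum_val y) r)) * cas (chi (enum_val x) r) = 0.
    by rewrite big1 // => -[i t] _; rewrite real0 mul0r.
  under eq_bigr do rewrite mulr_suml.
  rewrite exchange_big /= (bigD1 x) //= [X in _ + X]big1 ?addr0 => [|y yx].
    under eq_bigr do rewrite -mulrA.
    rewrite -mulr_sumr cas_ortho eqxx muln1 => /eqP.
    by rewrite mulf_eq0 (negbTE N2) orbF => /eqP.
  under eq_bigr do rewrite -mulrA.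
  rewrite -mulr_sumr cas_ortho (inj_eq enum_val_inj) (negbTE yx).
  by rewrite muln0 mulr0.
move=> d B; move/fin_all_exists => [f fP] indep; rewrite leqNgt.
apply/negP => ltd.
(* Upper bound: with more matrices than unit entries, the table of transforms at unit entries has a
   nonzero left kernel vector [c]. The combination [G] then has zero transform at unit entries by
   choice of [c] and elsewhere by [defect_cas_ortho], so it vanishes by inversion, against
   independence. *)
pose C := \matrix_(y < d, x < #|unit_entries|)
   \sum_r f y r.1 r.2 * cas (chi (enum_val x) r).
have: kermx C != 0.
  rewrite kermx_eq0 -row_leq_rank -ltnNge.
  exact: leq_ltn_trans (rank_leq_col _) ltd.
case/rowV0Pn => c /sub_kermxP cC; case/negP.
pose G i t := \sum_y c 0 y * f y i t.
have G_ortho p : \sum_r G r.1 r.2 * cas (chi p r) = 0.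
  rewrite /G; under eq_bigr do rewrite mulr_suml.
  rewrite exchange_big /=; under eq_bigr do under eq_bigr do rewrite -mulrA.
  under eq_bigr do rewrite -mulr_sumr.
  have [pS|pS] := boolP (p \in unit_entries); last first.
    by rewrite big1 // => y _; rewrite (defect_cas_ortho (proj1 (fP y)) pS) mulr0.
  move/matrixP/(_ 0 (enum_rank_in pS p)): cC; rewrite !mxE => cC.
  rewrite -[RHS]cC; apply: eq_bigr => y _; rewrite mxE.
  by rewrite enum_rankK_in.
have G0 i t : G i t = 0.
  have := cas_expand (fun r => G r.1 r.2) (i, t).
  under eq_bigr do rewrite G_ortho mul0r.
  by rewrite big1 //= => /esym/eqP; rewrite mulf_eq0 (negbTE N2) => /eqP.
apply/eqP/rowP => y; rewrite mxE; apply: (indep (fun y => c 0 y)) => i t.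
have -> : \sum_x real_complex _ (c 0 x) * B x i t
        = 'i * F i t * real_complex _ (G i t).
  rewrite /G rmorph_sum /= mulr_sumr; apply: eq_bigr => x _.
  by rewrite (proj2 (fP x)) rmorphM /=; ring.
by rewrite G0 rmorph0 mulr0.
Qed.

End Bicharacter.

(** * Kronecker products of Fourier matrices *)

(** Distributivity for dependent functions. The detour through [fprod] encodes them as ordinary
    functions into a tagged union, where [bigA_distr_big_dep] applies. *)
Lemma sum_prod_dffun (K : pzSemiRingType) (I : finType) (T_ : I -> finType)
    (P_ : forall i, T_ i -> K) :
  \sum_(g : {dffun forall i, T_ i}) \prod_i P_ i (g i) = \prod_i \sum_j P_ i j.
Proof.
rewrite (reindex (@dffun_of_fprod I T_)); last first.
  exact/onW_bij/dffun_of_fprod_bij.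
transitivity (\sum_(t : fprod T_) \prod_(i in I) [ffun j => P_ i j] (t i)).
  by apply: eq_bigr => t _; apply: eq_bigr => i _; rewrite !ffunE.
rewrite (big_fprod _ _ (fun i => [ffun j => P_ i j])).
transitivity (\prod_i \sum_(j in tagged_with T_ i)
    untag 0 [ffun j => P_ i j] j); first by rewrite bigA_distr_big_dep.
apply: eq_bigr => i _; rewrite -(big_tag (fun i => [ffun j => P_ i j])).
by apply: eq_bigr => j _; rewrite ffunE.
Qed.

Lemma sum_unity_root (K : fieldType) (v : K) n :
  v ^+ n = 1 -> \sum_(t < n) v ^+ t = (n * (v == 1))%:R.
Proof.
move=> vn1; case: eqVneq => [->|v1].
  under eq_bigr do rewrite expr1n.
  by rewrite sumr_const card_ord muln1.
have := subrX1 v n; rewrite vn1 subrr muln0 => /esym/eqP.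
by rewrite mulf_eq0 subr_eq0 (negbTE v1) => /eqP.
Qed.

(** * Primitivity of the trigonometric root of unity *)

Section RootOfUnity.
Variable R : realType.

Lemma root_n_exp n j : root_n R n ^+ j =
  Complex (cos (2 * pi / n%:R *+ j)) (sin (2 * pi / n%:R *+ j)).
Proof.
elim: j => [|j IHj]; first by rewrite expr0 !mulr0n cos0 sin0.
rewrite exprS IHj [_ *+ j.+1]mulrS cosD sinD; apply/eqP.
by rewrite eq_complex /= eqxx addrC eqxx.
Qed.

Lemma root_n_primitive n : (0 < n)%N -> n.-primitive_root (root_n R n).
Proof.
move=> n0; rewrite /primitive_root_of_unity n0 /=.
have nR0 : n%:R != 0 :> R by rewrite pnatr_eq0 -lt0n.
apply/forallP => -[j /= ltjn]; apply/eqP; rewrite unity_rootE root_n_exp.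
have [<-|neq_jn] := eqVneq j.+1 n.
  rewrite -mulr_natr mulfVK; last by rewrite pnatr_eq0.
  by rewrite mulrC mulr_natr cos2pi sin2pi eqxx.
apply/negP; rewrite eq_complex /= => /andP[/eqP cos1 _].
(* The half angle lies strictly between 0 and $\pi$, so its sine is positive; but a cosine of 1 at
   the doubled angle would make that sine zero. *)
have: 0 < sin (pi / n%:R *+ j.+1 : R).
  apply: sin_gt0_pi; rewrite -mulr_natr -mulrA; apply/andP; split.
    by rewrite !mulr_gt0 ?pi_gt0 ?invr_gt0 ?ltr0n.
  rewrite gtr_pMr ?pi_gt0 // mulrC ltr_pdivrMr ?ltr0n // mul1r ltr_nat.
  by rewrite ltn_neqAle neq_jn.
have := cos1; rewrite (_ : _ *+ j.+1 = (pi / n%:R *+ j.+1) *+ 2).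
  rewrite cos_mulr2n => /eqP.
  rewrite subr_eq -[1 + 1]/(1 *+ 2) eqrMn2r /= => /eqP cos2.
  have := cos2Dsin2 (pi / n%:R *+ j.+1 : R).
  rewrite cos2 => /eqP; rewrite -subr_eq0 addrAC subrr add0r sqrf_eq0.
  by move=> /eqP ->; rewrite ltxx.
by rewrite -mulrA [2 * _]mulrC mulr_natr -!mulrnA mulnC.
Qed.

Lemma root_n_conj n : root_n R n * (root_n R n)^* = 1.
Proof.
rewrite -[(_ ^*)]/(conjc _); apply/eqP; rewrite eq_complex /=.
rewrite mulrN opprK mulrN [sin _ * cos _]mulrC addNr eqxx andbT.
by rewrite -!expr2 cos2Dsin2.
Qed.

End RootOfUnity.

(** * Character sums over the indexing group *)

Section FourierKron.
Variables (R : realType) (a s : nat) (k : 'I_s -> nat).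
Hypothesis a_gt0 : (0 < a)%N.
Local Notation F := (FourierKron R a k).
Local Notation w x := (root_n R (a ^ k x)).

Let n_gt0 x : (0 < a ^ k x)%N.
Proof. by rewrite expn_gt0 a_gt0. Qed.

Let w_prim x : (a ^ k x).-primitive_root (w x).
Proof. exact: root_n_primitive. Qed.

Definition IF_zero : IF a k := finfun (fun x => Ordinal (n_gt0 x)).

Definition IF_add (i j : IF a k) : IF a k :=
  finfun (fun x => Ordinal (ltn_pmod (i x + j x) (n_gt0 x))).

Lemma FourierKron_sym i j : F i j = F j i.
Proof. by apply: eq_bigr => x _; rewrite mulnC. Qed.

Lemma FourierKron_zero j : F IF_zero j = 1.
Proof. by apply: big1 => x _; rewrite ffunE mul0n expr0. Qed.

Lemma FourierKron_add i j t : F (IF_add i j) t = F i t * F j t.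
Proof.
rewrite -big_split; apply: eq_bigr => x _; rewrite ffunE /=.
by rewrite exprM (prim_expr_mod (w_prim x)) -exprM mulnDl exprD.
Qed.

Lemma FourierKron_conj i t : F i t * (F i t)^* = 1.
Proof.
rewrite rmorph_prod -big_split; apply: big1 => x _ /=.
by rewrite rmorphXn -exprMn root_n_conj expr1n.
Qed.

Lemma card_IF : #|IF a k| = Nsize a k.
Proof.
rewrite /IF card_dep_ffun /Nsize expn_sum /image_mem foldrE big_map big_enum.
by apply: eq_bigr => x _; rewrite card_ord.
Qed.

(** The sum factors into one geometric sum per coordinate, and a single coordinate with [u x != 1]
    annihilates the product. Orthogonality, [kills_FourierKron] and [card_row_unit] all rest on
    this. *)
Lemma sum_prod_unity_root (u : 'I_s -> R[i]) :
  (forall x, u x ^+ (a ^ k x) = 1) ->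
  \sum_(t : IF a k) \prod_x u x ^+ t x = (#|IF a k| * [forall x, u x == 1])%:R.
Proof.
move=> u1.
transitivity (\prod_x \sum_(j < a ^ k x) u x ^+ j); first exact: sum_prod_dffun.
under eq_bigr do rewrite sum_unity_root //.
rewrite -natr_prod; congr _%:R.
case: (boolP [forall x, u x == 1]) => [/forallP u_eq1|].
  rewrite card_IF muln1 /Nsize expn_sum.
  by apply: eq_bigr => x _; rewrite u_eq1 muln1.
rewrite negb_forall => /existsP[x ux].
by rewrite (bigD1 x) //= (negbTE ux) !muln0 mul0n.
Qed.

Lemma FourierKron_ortho i j :
  \sum_t F i t * (F j t)^* = (#|IF a k| * (i == j))%:R.
Proof.
transitivity (\sum_(t : IF a k) \prod_x (w x ^+ i x * (w x ^+ j x)^*) ^+ t x).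
  apply: eq_bigr => t _; rewrite rmorph_prod -big_split.
  by apply: eq_bigr => x _; rewrite /= exprMn -rmorphXn -!exprM.
have conj_w x m : (w x ^+ m)^* * w x ^+ m = 1.
  by rewrite rmorphXn -exprMn [_ * w x]mulrC root_n_conj expr1n.
rewrite sum_prod_unity_root => [|x].
  (* Both indices are below the order of the primitive root [w x], so equal powers force equal
     coordinates. *)
  congr (_ * nat_of_bool _)%:R; apply/forallP/eqP => [wij|-> x].
    apply/ffunP => x; apply/val_inj/eqP => /=.
    have := wij x; rewrite -(inj_eq (mulIf (_ : w x ^+ j x != 0))); last first.
      by rewrite expf_neq0 // (prim_root_eq0 (w_prim x)) -lt0n.
    rewrite -mulrA conj_w mulr1 mul1r (eq_prim_root_expr (w_prim x)).
    by rewrite !modn_small.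
  by rewrite mulrC conj_w.
rewrite exprMn -rmorphXn -!exprM ![(_ * a ^ k x)%N]mulnC !exprM.
by rewrite (prim_expr_order (w_prim x)) !expr1n rmorph1 mulr1.
Qed.

Lemma undephased_defect_FourierKron :
  is_undephased_defect F #|unit_entries F|.
Proof.
exact: undephased_defect_bichar FourierKron_sym FourierKron_add
  FourierKron_zero FourierKron_conj FourierKron_ortho.
Qed.

Lemma FourierKron_exp i j t :
  F i j ^+ t = \prod_x (w x ^+ (t * i x)) ^+ j x.
Proof.
rewrite /FourierKron -prodrXl; apply: eq_bigr => x _.
by rewrite -!exprM mulnAC [(i x * t)%N]mulnC.
Qed.

Lemma FourierKron_killed i t : kills t i -> forall j, F i j ^+ t = 1.
Proof.
move=> /forallP ti j; rewrite FourierKron_exp big1 // => x _.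
by move: (ti x); rewrite (prim_order_dvd (w_prim x)) => /eqP->; rewrite expr1n.
Qed.

(** The [t]-th powers of row [i] sum to the nonzero number [#|IF a k|], so by [sum_prod_unity_root]
    every coordinate root is 1. *)
Lemma kills_FourierKron i t : (forall j, F i j ^+ t = 1) -> kills t i.
Proof.
move=> Fij; have: \sum_(j : IF a k) \prod_x (w x ^+ (t * i x)) ^+ j x
    = (#|IF a k|)%:R.
  under eq_bigr do rewrite -FourierKron_exp Fij.
  by rewrite sumr_const.
rewrite sum_prod_unity_root => [/eqP|x].
  rewrite eqr_nat; case: forallP => [wti _|_].
    by apply/forallP => x; rewrite (prim_order_dvd (w_prim x)) wti.
  by rewrite muln0 card_IF /Nsize eq_sym expn_eq0 eqn0Ngt a_gt0.
by rewrite -exprM mulnC exprM (prim_expr_order (w_prim x)) expr1n.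
Qed.

(** Count $\sum_h\sum_{t<d}F_{gh}^t$ twice. Summing over [t] first gives [d] for each entry equal to
    1; summing over [h] first leaves only [t = 0], because no smaller positive [t] kills [g]. *)
Lemma card_row_unit g d : has_order g d ->
  (#|[set h | F g h == 1%R]| * d = Nsize a k)%N.
Proof.
case/and3P=> d_gt0 d_kills /forallP d_min.
apply/eqP; rewrite -(eqr_nat R[i]) natrM -card_IF; apply/eqP.
transitivity (\sum_h \sum_(t < d) F g h ^+ t).
  under eq_bigr do rewrite sum_unity_root ?FourierKron_killed //.
  rewrite -natr_sum -natrM; congr _%:R.
  rewrite -big_distrr mulnC /=; congr (_ * _)%N.
  by rewrite -sum1_card big_mkcond; apply: eq_bigr => h _; rewrite inE; case: eqP.
rewrite exchange_big /= (bigD1 (Ordinal d_gt0)) //= [X in _ + X]big1.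
  rewrite addr0; under eq_bigr do rewrite expr0.
  by rewrite sumr_const.
move=> t t0; under eq_bigr do rewrite FourierKron_exp.
rewrite sum_prod_unity_root => [|x]; last first.
  by rewrite -exprM mulnC exprM (prim_expr_order (w_prim x)) expr1n.
have := d_min t; rewrite lt0n; case: eqP => [t0'|_ /=].
  by case/eqP: t0; apply: val_inj.
case: forallP => [wt|_]; last by rewrite muln0.
case/negP; apply/forallP => x.
by rewrite (prim_order_dvd (w_prim x)) wt.
Qed.

Lemma has_order_uniq (g : IF a k) t u : has_order g t -> has_order g u -> t = u.
Proof.
case/and3P=> t0 tg /forallP tmin /and3P[u0 ug /forallP umin].
case: (ltngtP t u) => // [tu|ut].
  by have := umin (Ordinal tu); rewrite /= t0 tg.
by have := tmin (Ordinal ut); rewrite /= u0 ug.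
Qed.

Lemma kills_dvd (g : IF a k) t u : (t %| u)%N -> kills t g -> kills u g.
Proof.
move=> tu /forallP tg; apply/forallP => x; apply: dvdn_trans (tg x) _.
by rewrite dvdn_mul.
Qed.

Lemma kills_gcdn (g : IF a k) t u : kills t g -> kills u g -> kills (gcdn t u) g.
Proof.
move=> /forallP tg /forallP ug; apply/forallP => x.
by rewrite muln_gcdl dvdn_gcd tg ug.
Qed.

Lemma kills_kmax (g : IF a k) : kills (a ^ kmax k) g.
Proof.
apply/forallP => x; apply: dvdn_mulr; apply: dvdn_exp2l.
exact: (leq_bigmax_cond (F := k)).
Qed.

End FourierKron.

(** * Orders of elements and rows when [a] is prime *)

Section PrimePower.
Variables (R : realType) (a s : nat) (k : 'I_s -> nat).
Hypothesis a_prime : prime a.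
Local Notation F := (FourierKron R a k).

Let a_gt0 : (0 < a)%N := prime_gt0 a_prime.

(** The order of [v] divides $a^{m+1}$, hence is a power of [a]; any smaller power would divide
    $a^m$. *)
Lemma prime_power_primitive (K : fieldType) (v : K) m :
  v ^+ (a ^ m.+1) = 1 -> v ^+ (a ^ m) != 1 -> (a ^ m.+1).-primitive_root v.
Proof.
move=> v1 v_neq1.
have [|d d_prim] := prim_order_exists _ v1; first by rewrite expn_gt0 a_gt0.
case/(dvdn_pfactor _ _ a_prime) => l; rewrite leq_eqVlt => /predU1P[-> dE|lm dE].
  by rewrite -dE.
case/negP: v_neq1; rewrite -(prim_order_dvd d_prim) dE.
exact: dvdn_exp2l.
Qed.

Lemma has_order_prime1 (g : IF a k) : has_order g (a ^ 0) = kills (a ^ 0) g.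
Proof.
rewrite /has_order /=; case: kills => //=; apply/forallP => u.
by case: u => -[].
Qed.

(** Minimality need only be tested at $a^m$: if a positive $u<a^{m+1}$ kills [g], so does
    $\gcd(u,a^{m+1})$, which is a power of [a] dividing $a^m$. *)
Lemma has_order_primeS (g : IF a k) m :
  has_order g (a ^ m.+1) = kills (a ^ m.+1) g && ~~ kills (a ^ m) g.
Proof.
rewrite /has_order expn_gt0 a_gt0 /=; case: (boolP (kills _ g)) => //= am1.
have am_lt : (a ^ m < a ^ m.+1)%N by rewrite ltn_exp2l ?prime_gt1.
apply/forallP/idP => [min_am1|not_am u].
  have := min_am1 (Ordinal am_lt).
  by rewrite /= expn_gt0 a_gt0.
apply/implyP => u_gt0; apply: contra not_am => ug.
have := kills_gcdn ug am1.
case/(dvdn_pfactor _ _ a_prime): (dvdn_gcdr u (a ^ m.+1)) => l _ gE.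
rewrite gE; apply: kills_dvd; apply: dvdn_exp2l; rewrite -ltnS.
rewrite -(ltn_exp2l _ _ (prime_gt1 a_prime)) -gE.
exact: leq_ltn_trans (dvdn_leq u_gt0 (dvdn_gcdl _ _)) (ltn_ord u).
Qed.

Lemma has_order_exists (g : IF a k) :
  exists2 m, (m <= kmax k)%N & has_order g (a ^ m).
Proof.
have ex_m : exists m, kills (a ^ m) g by exists (kmax k); exact: kills_kmax.
case: (ex_minnP ex_m) => -[|m] m_kills m_min.
  by exists 0%N; rewrite // has_order_prime1.
exists m.+1; first exact/m_min/kills_kmax.
rewrite has_order_primeS m_kills; apply/negP => /m_min.
by rewrite ltnn.
Qed.

Lemma has_order_row_is_roots m (i : IF a k) :
  has_order i (a ^ m) <-> row_is_roots F i (a ^ m).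
Proof.
have zeta_prim : (a ^ m).-primitive_root (root_n R (a ^ m)).
  by apply: root_n_primitive; rewrite expn_gt0 a_gt0.
split=> [ord_i|[i_roots roots_i]]; last first.
  apply/and3P; split; first by rewrite expn_gt0 a_gt0.
    exact: kills_FourierKron i_roots.
  apply/forallP => u; apply/implyP => u_gt0; apply/negP => ui.
  (* Some entry of the row is a primitive root of order $a^m$, which rules out every smaller
     positive exponent. *)
  have [j Fij] := roots_i _ (prim_expr_order zeta_prim).
  have /eqP := FourierKron_killed R a_gt0 ui j.
  rewrite Fij -(prim_order_dvd zeta_prim) => /(dvdn_leq u_gt0).
  by rewrite leqNgt ltn_ord.
case/and3P: (ord_i) => _ i_kills _; split=> [j|z z1].
  exact: FourierKron_killed.
case: m ord_i i_kills z1 {zeta_prim} => [|m] ord_i i_kills z1.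
  exists (IF_zero k a_gt0); rewrite FourierKron_sym FourierKron_zero.
  by rewrite -[RHS]expr1.
move: ord_i; rewrite has_order_primeS i_kills /= negb_forall => /existsP[x not_am].
have w_prim y : (a ^ k y).-primitive_root (root_n R (a ^ k y)).
  by apply: root_n_primitive; rewrite expn_gt0 a_gt0.
have v_prim : (a ^ m.+1).-primitive_root (root_n R (a ^ k x) ^+ i x).
  apply: prime_power_primitive; rewrite -exprM mulnC.
    by move/forallP: i_kills => /(_ x); rewrite (prim_order_dvd (w_prim x)) => /eqP.
  by rewrite -(prim_order_dvd (w_prim x)).
have [t ->] := prim_rootP v_prim z1.
have n_gt0 y : (0 < a ^ k y)%N by rewrite expn_gt0 a_gt0.
(* The column is zero off the coordinate [x], so the entry reduces to a power of the primitive root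
   [v_prim]. Reducing [t] modulo $a^{k_x}$ is harmless because [w x] has that order. *)
exists (finfun (fun y =>
  Ordinal (ltn_pmod (if y == x then val t else 0%N) (n_gt0 y)))).
rewrite /FourierKron (bigD1 x) //= big1 ?mulr1 => [|y yx].
  by rewrite ffunE /= eqxx mulnC exprM (prim_expr_mod (w_prim x)) -exprM mulnC exprM.
by rewrite ffunE /= (negbTE yx) mod0n muln0 expr0.
Qed.

(** In each of the [q] blocks of length [d], only the first element is a multiple of [d]. *)
Lemma sum_dvdn_period d q : (0 < d)%N -> (\sum_(j < q * d) (d %| j) = q)%N.
Proof.
move=> d_gt0; rewrite -(big_mkord xpredT (fun j => (d %| j : nat)))%N big_nat_mul.
transitivity (\sum_(0 <= i < q) 1)%N; last by rewrite sum_nat_const_nat subn0 muln1.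
apply: eq_bigr => i _.
rewrite big_ltn ?ltn_mul2r ?d_gt0 //= dvdn_mull // big_nat big1 // => j.
case/andP=> lo hi; apply/eqP; rewrite eqb0; apply/negP => /dvdnP[l jE].
by move: lo hi; rewrite jE !ltn_mul2r d_gt0 /= => /leq_ltn_trans h /h; rewrite ltnn.
Qed.

(** For $n\le m$ every [j] qualifies; otherwise cancelling $a^m$ leaves the condition that $a^{n-m}$
    divides [j]. *)
Lemma sum_killed_ord n m :
  (\sum_(j < a ^ n) (a ^ n %| a ^ m * j) = a ^ minn n m)%N.
Proof.
case: (leqP n m) => [le_nm|/ltnW le_mn].
  under eq_bigr => j _ do rewrite dvdn_mulr ?dvdn_exp2l //.
  by rewrite big_const_ord iter_addn_0 mul1n.
have nE : (a ^ n = a ^ m * a ^ (n - m))%N by rewrite -expnD subnKC.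
transitivity (\sum_(j < a ^ m * a ^ (n - m)) (a ^ (n - m) %| j))%N.
  rewrite -nE; apply: eq_bigr => j _.
  by rewrite [X in (X %| _)%N]nE dvdn_pmul2l // expn_gt0 a_gt0.
by rewrite sum_dvdn_period // expn_gt0 a_gt0.
Qed.

Lemma card_kills m :
  #|[set g : IF a k | kills (a ^ m) g]| = (a ^ \sum_x minn (k x) m)%N.
Proof.
rewrite expn_sum -sum1_card big_mkcond /=.
transitivity (\sum_(g : IF a k) \prod_x (a ^ k x %| a ^ m * g x))%N.
  apply: eq_bigr => g _; rewrite inE /kills; case: forallP => [gP|].
    by rewrite big1 // => x _; rewrite gP.
  move/forallP; rewrite negb_forall => /existsP[x gx].
  by rewrite (bigD1 x) //= (negbTE gx).
transitivity (\prod_x \sum_(j < a ^ k x) (a ^ k x %| a ^ m * j))%N.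
  exact: (sum_prod_dffun (fun x (j : 'I_(a ^ k x)) => (a ^ k x %| a ^ m * j : nat)))%N.
by apply: eq_bigr => x _; rewrite sum_killed_ord.
Qed.

Lemma n_ord0 : n_ord a k 0 = 1%N.
Proof.
rewrite /n_ord; under eq_finset do rewrite has_order_prime1.
by rewrite card_kills; under eq_bigr do rewrite minn0; rewrite big1.
Qed.

Lemma n_ordS m : (n_ord a k m.+1 + a ^ (\sum_x minn (k x) m)
  = a ^ (\sum_x minn (k x) m.+1))%N.
Proof.
rewrite -!card_kills /n_ord.
rewrite -(cardsID [set g : IF a k | kills (a ^ m) g]
                  [set g : IF a k | kills (a ^ m.+1) g]) addnC.
congr (_ + _)%N; apply: eq_card => g; rewrite !inE.
  apply/idP/andP => [am|[]//]; split=> //.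
  by apply: kills_dvd am; rewrite dvdn_exp2l.
by rewrite has_order_primeS andbC.
Qed.

(** Every row has exactly one order $a^m$ with $m\le k_{\max}$ and contributes $N/a^m$ by
    [card_row_unit]; exchanging the sums groups the rows by order. *)
Lemma card_unit_entries : #|unit_entries F|%:Q
  = \sum_(m < (kmax k).+1) (Nsize a k)%:Q / a%:Q ^+ m * (n_ord a k m)%:Q.
Proof.
have aQ : (a%:Q : rat) != 0 by rewrite intr_eq0 -lt0n.
have -> : #|unit_entries F| = (\sum_g #|[set h | F g h == 1%R]|)%N.
  rewrite -sum1_card big_mkcond.
  transitivity (\sum_p (F p.1 p.2 == 1%R))%N.
    by apply: eq_bigr => p _; rewrite inE; case: eqP.
  rewrite -(pair_bigA _ (fun g h => F g h == 1%R : nat)) /=.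
  apply: eq_bigr => g _; rewrite -sum1_card [RHS]big_mkcond.
  by apply: eq_bigr => h _; rewrite !inE; case: eqP.
have n_ordE m : (n_ord a k m)%:Q = \sum_g (has_order (g : IF a k) (a ^ m))%:R.
  rewrite /n_ord -sum1_card big_mkcond /= -natr_sum pmulrn.
  by congr _%:R; apply: eq_bigr => g _; rewrite inE; case: has_order.
under [RHS]eq_bigr do rewrite n_ordE mulr_sumr.
rewrite exchange_big /= -pmulrn natr_sum; apply: eq_bigr => g _.
have [m le_m ord_g] := has_order_exists g.
rewrite (bigD1 (Ordinal (le_m : m < _.+1)%N)) //= [X in _ + X]big1 ?addr0.
  rewrite ord_g mulr1 -!pmulrn -natrX -(card_row_unit R a_gt0 ord_g) natrM mulfK //.
  by rewrite natrX expf_neq0.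
move=> l lm; case: (boolP (has_order g (a ^ l))) => [ord_l|_]; last by rewrite mulr0.
case/eqP: lm; apply: val_inj; apply: (expnI (prime_gt1 a_prime)).
exact: has_order_uniq ord_l ord_g.
Qed.

End PrimePower.

(** * Arithmetic of the exponents *)

Section Multiplicities.
Variables (s : nat) (k : 'I_s -> nat).

(** Equals $s-K(m)$; for $m\ge1$ these are the parts of the partition conjugate to the $k_x$, and
    the increments of [sum_minn]. *)
Definition count_ge m : nat := #|[set x | (m <= k x)%N]|.

Definition sum_minn m : nat := (\sum_x minn (k x) m)%N.

Lemma count_ge_Kc m : (count_ge m + Kc k m = s)%N.
Proof.
rewrite -[RHS]card_ord -(cardsC [set x | (m <= k x)%N]).
by congr (_ + _)%N; apply: eq_card => x; rewrite !inE ltnNge.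
Qed.

Lemma count_geE m : count_ge m = (\sum_x (m <= k x))%N.
Proof.
rewrite /count_ge -sum1_card big_mkcond.
by apply: eq_bigr => x _; rewrite inE; case: leqP.
Qed.

Lemma count_ge_anti m n : (m <= n)%N -> (count_ge n <= count_ge m)%N.
Proof.
by move=> mn; apply/subset_leq_card/subsetP => x; rewrite !inE; apply: leq_trans.
Qed.

Lemma count_ge_strict x n : (k x < n)%N -> (count_ge n < count_ge (k x))%N.
Proof.
move=> xn; apply/proper_card/properP; split.
  by apply/subsetP => y; rewrite !inE; apply/leq_trans/ltnW.
by exists x; rewrite !inE ?leqnn // -ltnNge.
Qed.

Lemma count_ge_gt0 x m : (m <= k x)%N -> (0 < count_ge m)%N.
Proof. by move=> mx; apply/card_gt0P; exists x; rewrite inE. Qed.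

Lemma sum_minn0 : sum_minn 0 = 0%N.
Proof. by rewrite /sum_minn; under eq_bigr do rewrite minn0; rewrite big1. Qed.

Lemma sum_minnS m : sum_minn m.+1 = (sum_minn m + count_ge m.+1)%N.
Proof.
rewrite /sum_minn count_geE -big_split.
by apply: eq_bigr => x _ /=; lia.
Qed.

(** Summing the increments $s-K(l)$ for $1\le l\le m$. This is the passage between the exponents of
    (b) and (c), in additive form to avoid truncated subtraction. *)
Lemma sum_minn_sumK1 m : (sum_minn m + sumK1 k m = s * m + m)%N.
Proof.
elim: m => [|m IHm]; first by rewrite sum_minn0 /sumK1 big_geq // muln0.
have := count_ge_Kc m.+1; rewrite sum_minnS /sumK1 big_nat_recr //= -/(sumK1 k m).
by rewrite mulnS; lia.
Qed.

Lemma leq_kmax x : (k x <= kmax k)%N.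
Proof. exact: (leq_bigmax_cond (F := k)). Qed.

Lemma sum_minn_kmax : sum_minn (kmax k) = (\sum_x k x)%N.
Proof. by apply: eq_bigr => x _; apply/minn_idPl/leq_kmax. Qed.

Lemma kmax_attained : (0 < s)%N -> exists x, k x = kmax k.
Proof.
move=> s_gt0; have [|x xE] := bigop.eq_bigmax k; first by rewrite card_ord.
by exists x.
Qed.

Lemma kmax_onceE : kmax_once k = (count_ge (kmax k) == 1%N).
Proof.
congr (_ == _); apply: eq_card => x; rewrite !inE.
by rewrite eqn_leq leq_kmax.
Qed.

(** Since no $k_x$ lies strictly between the bounds, each minimum is constantly $k_x$ or constantly
    [m] on the interval. *)
Lemma sum_minn_gap alpha beta m : (alpha < beta)%N ->
  (forall x, (k x <= alpha)%N || (beta <= k x)%N) -> (alpha <= m <= beta)%N ->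
  sum_minn m = (sum_le k alpha + count_ge beta * m)%N.
Proof.
move=> ab gap /andP[am mb].
rewrite /sum_minn /sum_le count_geE big_distrl /= [X in (X + _)%N]big_mkcond.
rewrite -big_split; apply: eq_bigr => x _ /=.
by have := gap x; case: (leqP (k x) alpha); case: (leqP beta (k x)) => //=; lia.
Qed.

Lemma count_ge_gap alpha beta m :
  (forall x, (k x <= alpha)%N || (beta <= k x)%N) -> (alpha < m <= beta)%N ->
  count_ge m = count_ge beta.
Proof.
move=> gap /andP[am mb]; apply: eq_card => x; rewrite !inE.
by have := gap x; lia.
Qed.

(** * The distinct values $c_0<\dots<c_r$ *)

Lemma cseq_sorted : sorted ltn (cseq k).
Proof.
rewrite /cseq /= path_min_sorted.
  by rewrite ltn_sorted_uniq_leq sort_uniq undup_uniq (sort_sorted leq_total).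
apply/allP => v; rewrite mem_sort mem_undup => /mapP[x].
by rewrite mem_filter -lt0n => /andP[x0 _] ->.
Qed.

Lemma size_cseq : size (cseq k) = (rnum k).+1.
Proof. by []. Qed.

Lemma cval_lt i j : (i < j)%N -> (j <= rnum k)%N -> (cval k i < cval k j)%N.
Proof.
move=> ij jr; apply: (sorted_ltn_nth ltn_trans 0%N cseq_sorted) => //.
by rewrite inE size_cseq ltnS (leq_trans (ltnW ij)).
Qed.

Lemma cval_le i j : (i <= j)%N -> (j <= rnum k)%N -> (cval k i <= cval k j)%N.
Proof.
by rewrite leq_eqVlt => /predU1P[->//|ij jr]; apply/ltnW/cval_lt.
Qed.

Lemma cval_attained y : (0 < y <= rnum k)%N -> exists x, cval k y = k x.
Proof.
case: y => // y /andP[_ yr]; rewrite /cval /cseq /=.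
set c := sort _ _; have: nth 0%N c y \in c by rewrite mem_nth.
rewrite {2}/c mem_sort mem_undup => /mapP[x _ ->].
by exists x.
Qed.

Lemma cval_surj x : exists2 y, (y <= rnum k)%N & k x = cval k y.
Proof.
have: k x \in cseq k.
  rewrite inE mem_sort mem_undup; have [//|x0] := eqVneq (k x) 0%N.
  by apply/mapP; exists x; rewrite // mem_filter x0 mem_enum.
by case/(nthP 0%N) => y; rewrite size_cseq ltnS => yr xE; exists y.
Qed.

Lemma cval_gap y x : (0 < y <= rnum k)%N ->
  (k x <= cval k y.-1)%N || (cval k y <= k x)%N.
Proof.
case: y => // y /andP[_ yr]; have [j jr ->] := cval_surj x.
case: (leqP j y) => jy; apply/orP; [left | right]; apply: cval_le => //.
exact: ltnW.
Qed.

Lemma cval_rnum : cval k (rnum k) = kmax k.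
Proof.
apply/eqP; rewrite eqn_leq; apply/andP; split.
  have [r0|r_gt0] := posnP (rnum k); first by rewrite r0.
  by have [|x ->] := @cval_attained (rnum k); rewrite ?r_gt0 ?leqnn ?leq_kmax.
by apply/bigmax_leqP => x _; have [j jr ->] := cval_surj x; apply: cval_le.
Qed.

Lemma rnum_gt0 : (0 < kmax k)%N -> (0 < rnum k)%N.
Proof. by rewrite -cval_rnum; case: (rnum k). Qed.

(** * The interval from $c_{y-1}$ to $c_y$ *)

Section Step.
Variable y : nat.
Hypothesis y_range : (0 < y <= rnum k)%N.

Let y_lt : (cval k y.-1 < cval k y)%N.
Proof. by case: y y_range => // n /andP[_ nr]; apply: cval_lt. Qed.

Lemma count_ge_cval_gt0 : (0 < count_ge (cval k y))%N.
Proof. by have [x ->] := cval_attained y_range; apply: count_ge_gt0. Qed.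

(** The value $c_y$ is attained, so the count is positive and the truncated subtraction in [mu_y] is
    exact. *)
Lemma mu_yE : (mu_y k y).+1 = count_ge (cval k y).
Proof.
have := count_ge_Kc (cval k y); have := count_ge_cval_gt0; rewrite /mu_y.
by lia.
Qed.

Lemma sum_minn_cval m : (cval k y.-1 <= m <= cval k y)%N ->
  sum_minn m = (sum_le k (cval k y.-1) + (mu_y k y).+1 * m)%N.
Proof.
move=> m_range; rewrite mu_yE.
exact: sum_minn_gap y_lt (fun x => cval_gap x y_range) m_range.
Qed.

Lemma mu_y_eq0 : mu_y k y = 0%N <-> y = rnum k /\ kmax_once k.
Proof.
rewrite kmax_onceE -cval_rnum; split=> [mu0|[yr]].
  have yr : y = rnum k.
    (* If $y<r$, the count drops strictly beyond $c_y$, hence from 1 to 0, although $k_{\max}$ is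
       attained. *)
    case/andP: (y_range) => y_gt0; rewrite leq_eqVlt => /predU1P[//|yr].
    have [x xE] := cval_attained y_range.
    have := cval_lt yr (leqnn _); rewrite xE => /count_ge_strict.
    rewrite -xE -mu_yE mu0 ltnS leqn0 => /eqP c0.
    have [|z zE] := @cval_attained (rnum k); first by rewrite (ltn_trans y_gt0 yr) /=.
    by have := @count_ge_gt0 z (kmax k); rewrite -cval_rnum c0 zE leqnn => /(_ isT).
  by rewrite -yr -mu_yE mu0.
by rewrite -yr -mu_yE => /eqP[].
Qed.

Lemma horner_Ppoly (q : rat) : (Ppoly k y).[q] =
  q ^+ (sum_le k (cval k y.-1) + mu_y k y * (cval k y.-1).+1) *
  \sum_(d < cval k y - cval k y.-1) q ^+ (mu_y k y * d).
Proof.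
rewrite /Ppoly hornerM hornerXn horner_sum; congr (_ * _).
by apply: eq_bigr => d _; rewrite hornerXn.
Qed.

(** Put $m=\alpha+1+d$: on this interval [sum_minn] has slope $\mu+1$, so the exponent minus $m$ has
    slope $\mu$. Thus $P(\alpha,\beta)$ is one block of the sum in (b). *)
Lemma horner_Ppoly_sum (q : rat) : q != 0 ->
  (Ppoly k y).[q] = \sum_((cval k y.-1).+1 <= m < (cval k y).+1)
    q ^ (- m%:Z + (sum_minn m)%:Z).
Proof.
move=> q0; rewrite horner_Ppoly mulr_sumr big_add1 /=.
rewrite -[RHS]/(\sum_(0 + cval k y.-1 <= m < cval k y)
  q ^ (- (m.+1)%:Z + (sum_minn m.+1)%:Z)) big_addn big_mkord.
apply: eq_bigr => d _; rewrite -exprD exprnP; congr (q ^ _).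
rewrite sum_minn_cval; first by rewrite mulSn !mulnS mulnDr; lia.
by have := ltn_ord d; have := y_lt; lia.
Qed.

Lemma size_sum_powers (mu n : nat) :
  size (\sum_(d < n.+1) 'X^(mu * d) : {poly rat}) = (mu * n).+1.
Proof.
(* For $\mu=0$ all powers collapse to the constant $n+1$, nonzero over the rationals; otherwise the
   last power strictly dominates. *)
case: (posnP mu) => [->|mu_gt0].
  under eq_bigr do rewrite mul0n expr0.
  by rewrite sumr_const card_ord -polyC1 -polyCMn mul0n size_polyC pnatr_eq0.
elim: n => [|n IHn]; first by rewrite big_ord1 muln0 expr0 size_poly1.
rewrite big_ord_recr /= addrC size_polyDl size_polyXn // IHn.
by rewrite ltnS ltn_mul2l mu_gt0 /=.
Qed.

Lemma Pdeg_step : Pdeg k y = (sum_le k (cval k y.-1) + mu_y k y * cval k y)%N.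
Proof.
have y0 : y == 0%N = false by case: y y_range.
rewrite /Pdeg y0 /Ppoly; have := y_lt.
set mu := mu_y k y; set alpha := cval k y.-1; set beta := cval k y => ab.
have -> : (beta - alpha = (beta - alpha).-1.+1)%N by lia.
rewrite mulrC size_Mmonic ?monicXn //; last first.
  by rewrite -size_poly_eq0 size_sum_powers.
rewrite size_sum_powers size_polyXn addnS /= addnC -addnA -mulnDr.
by congr (_ + _ * _)%N; lia.
Qed.

End Step.

(** The degree is the exponent of the last summand, $m=c_y$, in the block. The formula includes
    $y=0$, the leading term 1, where everything is 0. *)
Lemma Pdeg_sum_minn y : (y <= rnum k)%N ->
  (Pdeg k y + cval k y = sum_minn (cval k y))%N.
Proof.
case: y => [|y] yr; first by rewrite (_ : cval k 0 = 0%N) // sum_minn0.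
have y_range : (0 < y.+1 <= rnum k)%N by [].
rewrite (Pdeg_step y_range) (sum_minn_cval y_range).
  by rewrite mulSn addnAC addnA [X in X = _]addnC addnCA addnA addnAC.
by rewrite leqnn andbT cval_le.
Qed.

Lemma PdegS y : (y < rnum k)%N ->
  Pdeg k y.+1 = (Pdeg k y + mu_y k y.+1 * (cval k y.+1 - cval k y))%N.
Proof.
move=> yr; have y_range : (0 < y.+1 <= rnum k)%N by [].
have le_c := cval_le (leqnSn y) yr.
have := Pdeg_sum_minn yr; have := Pdeg_sum_minn (ltnW yr).
rewrite (@sum_minn_cval y.+1) ?leqnn //= (@sum_minn_cval y.+1) ?leqnn ?andbT //.
rewrite mulnBr !mulSn.
have : (mu_y k y.+1 * cval k y <= mu_y k y.+1 * cval k y.+1)%N.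
  by rewrite leq_mul2l le_c orbT.
by rewrite /=; lia.
Qed.

End Multiplicities.

(** * Summation identities *)

Lemma sum_powers_by_parts (q C : rat) (A M : nat -> nat) n : q != 0 -> M 0 = 0%N ->
  A 0 = 1%N -> (forall m, (A m.+1)%:Q + q ^+ M m = q ^+ M m.+1) ->
  \sum_(m < n.+1) C / q ^+ m * (A m)%:Q
  = C / q * ((q - 1) * (1 + \sum_(1 <= m < n.+1) q ^ (- m%:Z + (M m)%:Z))
             + q ^ (- n%:Z + (M n)%:Z)).
Proof.
move=> q0 M0 A0 AS.
have powE m : q ^ (- m%:Z + (M m)%:Z) = q ^+ M m / q ^+ m.
  by rewrite expfzDr // mulrC -exprnN -exprnP.
(* With $p_m=q^{M_m-m}$, the term of index $m\ge1$ is $\frac Cq\big((q-1)p_m+p_m-p_{m-1}\big)$; the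
   differences telescope to the boundary term, and the term of index 0 is $\frac
   Cq\big((q-1)+1\big)$. *)
elim: n => [|n IHn].
  by rewrite big_ord1 A0 big_geq // powE M0 !expr0; field.
rewrite big_ord_recr /= IHn [in RHS]big_nat_recr //= !powE.
have -> : (A n.+1)%:Q = q ^+ M n.+1 - q ^+ M n by rewrite -AS addrK.
have qn0 : q ^+ n != 0 by rewrite expf_neq0.
by rewrite exprS; field; rewrite q0 qn0.
Qed.

(** Horner's scheme: [f m.+1] is the factor leading from [P m] to [P m.+1], so pushing [P i] inwards
    produces the successive terms. *)
Lemma foldr_nested (K : comPzRingType) (f P : nat -> K) i n :
  (forall m, (i <= m < i + n)%N -> P m.+1 = P m * f m.+1) ->
  P i * foldr (fun m acc => 1 + f m * acc) 1 (iota i.+1 n)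
  = \sum_(i <= m < (i + n).+1) P m.
Proof.
elim: n i => [|n IHn] i PS /=; first by rewrite addn0 big_nat1 mulr1.
rewrite mulrDr mulr1 mulrA -PS; last by rewrite leqnn -addSnnS leq_addr.
rewrite -addSnnS IHn; last first.
  by move=> m /andP[im mn]; apply: PS; rewrite (ltnW im) -addSnnS.
by rewrite [RHS]big_ltn // ltnS addSn ltnW // ltnS leq_addr.
Qed.

Lemma big_nat_blocks (V : nmodType) (f : nat -> V) (c : nat -> nat) n :
  (forall y, (y < n)%N -> (c y <= c y.+1)%N) ->
  \sum_(1 <= y < n.+1) \sum_((c y.-1).+1 <= m < (c y).+1) f m
  = \sum_((c 0%N).+1 <= m < (c n).+1) f m.
Proof.
elim: n => [|n IHn] c_le; first by rewrite !big_geq.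
rewrite big_nat_recr //= IHn => [|y yn]; last exact/c_le/ltnW.
have c0n m : (m <= n)%N -> (c 0%N <= c m)%N.
  elim: m => // m IHm mn; apply: leq_trans (IHm (ltnW mn)) _.
  by apply: c_le; apply: leq_trans mn _.
by rewrite -big_cat_nat //= ltnS ?c0n ?c_le.
Qed.

Theorem theorem5p4 (R : realType) (a s : nat) (k : 'I_s -> nat) :
  prime a -> (1 <= s)%N ->
  let F := FourierKron R a k in
  let N := Nsize a k in
  let km := kmax k in
  let Aq := (a%:Q) in
  let Nq := (N%:Q) in
  let r := rnum k in
  (km = 0%N -> is_undephased_defect F 1) /\
  ((0 < km)%N ->
   exists D : nat, is_undephased_defect F D /\
   (* (a) *)
   (D%:Q = \sum_(m < km.+1) Nq / Aq ^+ m * (n_ord a k m)%:Q /\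
    (forall m : nat, (m <= km)%N -> forall i : IF a k,
        has_order i (a ^ m) <-> row_is_roots F i (a ^ m))) /\
   (* (b) *)
   (D%:Q = Nq / Aq *
      ((Aq - 1) * (1 + \sum_(1 <= m < km.+1)
                        Aq ^ (- (m%:Z) + (\sum_(x < s) minn (k x) m)%N%:Z))
       + Aq ^ (- (km%:Z) + (\sum_(x < s) k x)%N%:Z))) /\
   (* (c) *)
   (D%:Q = Nq / Aq *
      ((Aq - 1) * (1 + \sum_(1 <= m < km.+1)
                        Aq ^ ((s * m)%N%:Z - (sumK1 k m)%:Z))
       + Aq ^ ((s * km)%N%:Z - (sumK1 k km)%:Z)) /\
    (s * km)%N%:Z - (sumK1 k km)%:Z = - (km%:Z) + (\sum_(x < s) k x)%N%:Z) /\
   (* (d) *)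
   ((forall y : nat, (1 <= y <= r)%N ->
       let alpha := cval k y.-1 in
       let beta := cval k y in
       let mu := mu_y k y in
       ((Kc k beta).+1 <= s)%N /\
       (sum_le k alpha + mu * alpha.+1)%N%:Z
         = (s * alpha.+1)%N%:Z - (sumK1 k alpha.+1)%:Z /\
       (mu = 0%N <-> (y = r /\ kmax_once k)) /\
       (mu = 0%N -> (Ppoly k y).[Aq] = Aq ^+ (sum_le k alpha) * (beta - alpha)%N%:Q) /\
       (mu <> 0%N -> (Ppoly k y).[Aq] =
          Aq ^+ (sum_le k alpha + mu * alpha.+1) *
          ((1 - Aq ^+ (mu * (beta - alpha))) / (1 - Aq ^+ mu)))) /\
    D%:Q = Nq / Aq *
      ((Aq - 1) * (1 + \sum_(1 <= y < r.+1) (Ppoly k y).[Aq])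
       + Aq ^ (- (km%:Z) + (\sum_(x < s) k x)%N%:Z)) /\
    (forall y : nat, (y.+1 < r)%N -> (Pdeg k y < Pdeg k y.+1)%N) /\
    (Pdeg k r.-1 <= Pdeg k r)%N /\
    (Pdeg k r.-1 = Pdeg k r <-> kmax_once k)) /\
   (* (e) *)
   (D%:Q = Nq / Aq *
      ((Aq - 1) * nested a k + Aq ^ ((s * km)%N%:Z - (sumK1 k km)%:Z)) /\
    (forall m : nat, (1 <= m <= km)%N ->
       0 <= e_m k m /\
       (e_m k m = 0 <-> (kmax_once k /\ (cval k r.-1 + 1 <= m <= cval k r)%N))))).
Proof.
move=> a_prime s_gt0 F N km Aq Nq r.
have a_gt1 := prime_gt1 a_prime.
have Aq0 : Aq != 0 by rewrite intr_eq0 -lt0n ltnW.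
(* The number of elements killed by $a^m$, divided by $a^m$: the summand common to (b), (c), (d) and
   (e). *)
pose P m := Aq ^ (- m%:Z + (sum_minn k m)%:Z).
have D_b : #|unit_entries F|%:Q = Nq / Aq *
    ((Aq - 1) * (1 + \sum_(1 <= m < km.+1) P m) + P km).
  rewrite (card_unit_entries R k a_prime); apply: sum_powers_by_parts => //.
  - exact: sum_minn0.
  - exact: n_ord0.
  - by move=> m; rewrite /Aq -!pmulrn -!natrX -natrD (n_ordS k a_prime).
have D_defect := undephased_defect_FourierKron R k (prime_gt0 a_prime).
have P_sumK1 m : P m = Aq ^ ((s * m)%N%:Z - (sumK1 k m)%:Z).
  by congr (_ ^ _); have := sum_minn_sumK1 k m; lia.
have P_kmax : P km = Aq ^ (- (km%:Z) + (\sum_(x < s) k x)%N%:Z).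
  by rewrite /P sum_minn_kmax.
split=> [km0|km_gt0].
  suff <- : #|unit_entries F| = 1%N by exact: D_defect.
  apply/eqP; rewrite -eqz_nat -(eqr_int rat); apply/eqP.
  rewrite (card_unit_entries R k a_prime) -/km km0.
  rewrite big_ord1 expr0 divr1 n_ord0 // mulr1 /Nsize big1 // => x _.
  by apply/eqP; rewrite -leqn0 -km0 leq_kmax.
exists #|unit_entries F|; split; first exact: D_defect.
have r_gt0 : (0 < r)%N := rnum_gt0 km_gt0.
have count_gt0 m : (m <= km)%N -> (0 < count_ge k m)%N.
  by move=> m_le; have [x xE] := kmax_attained k s_gt0; apply: (@count_ge_gt0 _ _ x); rewrite xE.
split; [split | split; [| split; [split | split; [split; [| split; [| split; [| split]]] | split]]]].
- exact: card_unit_entries.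
- by move=> m _ i; apply: has_order_row_is_roots.
- by rewrite -P_kmax.
- rewrite -P_sumK1; under eq_bigr do rewrite -P_sumK1.
  exact: D_b.
- have := sum_minn_sumK1 k km; rewrite sum_minn_kmax -/km.
  set S := (\sum_x k x)%N; lia.
- move=> y y_range alpha beta mu.
  have lt_ab : (alpha < beta)%N.
    by case: y y_range @alpha @beta @mu => // y /andP[_ yr]; apply: cval_lt.
  have muE : mu.+1 = count_ge k beta := mu_yE y_range.
  split; first by have := count_ge_Kc k beta; lia.
  split.
    have := sum_minn_sumK1 k alpha.+1.
    rewrite (sum_minn_cval y_range) -/alpha -/mu; last by rewrite leqnSn lt_ab.
    by rewrite mulSn; lia.
  split; first exact: mu_y_eq0.
  split=> mu0; rewrite horner_Ppoly -/alpha -/beta -/mu.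
    rewrite mu0 mul0n addn0; under eq_bigr do rewrite mul0n expr0.
    by rewrite sumr_const card_ord pmulrn.
  (* Since $\mu>0$ and $a>1$, the denominator of the geometric sum does not vanish. *)
  congr (_ * _); have q_neq1 : 1 - Aq ^+ mu != 0.
    rewrite subr_eq0 eq_sym /Aq -pmulrn -natrX pnatr_eq1 gtn_eqF //.
    by rewrite -[X in (X < _)%N](expn0 a) ltn_exp2l // lt0n; apply/eqP.
  apply: (mulIf q_neq1); rewrite mulfVK // mulrC exprM -opprB.
  rewrite mulNr; under eq_bigr do rewrite exprM.
  by rewrite -subrX1 opprB.
- rewrite D_b P_kmax; congr (_ * (_ * (_ + _) + _)).
  under [RHS]eq_big_nat => y y_range do rewrite horner_Ppoly_sum //.
  (* The blocks $c_{y-1}<m\le c_y$ tile $1,\dots,k_{\max}$, because $c_0=0$ and $c_r=k_{\max}$. *)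
  rewrite (big_nat_blocks P (c := cval k)) => [|y yr]; last exact: cval_le.
  by rewrite cval_rnum.
- move=> y yr; rewrite PdegS ?(ltnW yr) // -[X in (X < _)%N]addn0 ltn_add2l muln_gt0.
  rewrite subn_gt0 cval_lt ?(ltnW yr) // andbT lt0n; apply/eqP.
  by case/(@mu_y_eq0 _ k y.+1 (ltnW yr)) => yE _; move: yr; rewrite yE ltnn.
- by rewrite -{2}(prednK r_gt0) PdegS ?prednK // leq_addr.
- have r_range : (0 < r <= rnum k)%N by rewrite r_gt0 leqnn.
  have := @PdegS _ k r.-1; rewrite prednK // => /(_ (leqnn _)) ->.
  rewrite -[X in X = _]addn0; split=> [/addnI/esym/eqP|once].
    rewrite muln_eq0 subn_eq0 leqNgt cval_lt ?prednK // orbF => /eqP.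
    by case/(mu_y_eq0 r_range).
  by rewrite (mu_y_eq0 r_range).2.
- rewrite -P_sumK1 D_b; congr (_ * (_ * _ + _)).
  have P0 : P 0%N = 1 by rewrite /P sum_minn0.
  have -> : nested a k = \sum_(0 <= m < km.+1) P m; last first.
    by rewrite [RHS]big_ltn // P0.
  rewrite -[LHS]mul1r -P0.
  (* The ratio of consecutive terms is $a^{e_{m+1}}$, as [sum_minn] grows by [count_ge k m.+1],
     which is $e_{m+1}+1$. *)
  apply: (foldr_nested (f := fun m => Aq ^ e_m k m)) => m /andP[_ m_lt].
  rewrite /P -expfzDr //; congr (_ ^ _).
  have := count_gt0 _ m_lt; have := count_ge_Kc k m.+1; rewrite sum_minnS /e_m.
  lia.
- move=> m /andP[m_gt0 m_le]; have m_count := count_gt0 _ m_le.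
  have e_count : e_m k m = (count_ge k m)%:Z - 1.
    by have := count_ge_Kc k m; rewrite /e_m; lia.
  split; first by rewrite e_count; lia.
  have r_range : (0 < r <= rnum k)%N by rewrite r_gt0 leqnn.
  have gap x := @cval_gap _ k r x r_range.
  rewrite kmax_onceE addn1 -cval_rnum; split=> [e0|[/eqP once m_range]]; last first.
    by rewrite e_count (count_ge_gap gap m_range) once.
  have m_once : count_ge k m = 1%N by lia.
  rewrite cval_rnum m_le andbT; split.
    by have := count_ge_anti k m_le; have := count_gt0 _ (leqnn km); rewrite m_once /km; lia.
  (* If $m\le c_{r-1}$, then $c_{r-1}$ is positive, hence attained, and the count there is at most
     1; it must strictly exceed the count at $k_{\max}$, which is already at least 1. *)
  rewrite ltnNge; apply/negP => m_le_c.
  have rp_range : (0 < r.-1 <= rnum k)%N.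
    rewrite (leq_trans (leq_pred _)) // andbT lt0n; apply/eqP => rp0.
    by move: m_le_c; rewrite rp0 leqNgt m_gt0.
  have [x xE] := cval_attained rp_range.
  have := @cval_lt _ k r.-1 r; rewrite prednK // leqnn => /(_ isT isT).
  rewrite xE cval_rnum => /count_ge_strict.
  have := count_ge_anti k m_le_c; rewrite xE m_once.
  by have := count_gt0 _ (leqnn km); rewrite /km; lia.
Qed.
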